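(* Let $q$ be a prime power, $m,k,t$ positive integers with $k\le m$, $s\in\{1,\ldots,m\}$ with $\gcd(s,m)=1$, and $\{\alpha_1,\ldots,\alpha_t\}\subseteq\mathbb{F}_{q^m}^*$ a set whose elements have pairwise distinct norms $\mathrm{N}_s(\alpha_i)$. For $i\in\{1,\ldots,t\}$ let \[ \mathcal{U}^{-s}_i=\{(x,\mathrm{N}_{-s}^1(\alpha_i)x^{q^{-s}},\ldots,\mathrm{N}_{-s}^{k-1}(\alpha_i)x^{q^{-s(k-1)}}):x\in\mathbb{F}_{q^m}\}, \] \[ \mathcal{U}^{s}_i=\{(x,\mathrm{N}_s^1(\mu_i)x^{q^s},\ldots,\mathrm{N}_s^{k-1}(\mu_i)x^{q^{s(k-1)}}):x\in\mathbb{F}_{q^m}\},\qquad \mu_i=(\alpha_i^{-1})^{q^{-s(k-2)}}. \] Then $(\mathcal{U}^{-s}_1,\ldots,\mathcal{U}^{-s}_t)$ is equivalent to $(\mathcal{U}^{s}_1,\ldots,\mathcal{U}^{s}_t)$.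
   Context: For any integer $r$, $x^{q^r}$ denotes the image of $x$ under the $r$-th power of the Frobenius automorphism of $\mathbb{F}_{q^m}$ (negative $r$ allowed). For an integer $u$ coprime to $m$ and $\alpha\in\mathbb{F}_{q^m}$: $\mathrm{N}_u(\alpha)=\prod_{i=0}^{m-1}\alpha^{q^{ui}}$, $\mathrm{N}_u^0(\alpha)=1$ and $\mathrm{N}_u^j(\alpha)=\prod_{i=0}^{j-1}\alpha^{q^{ui}}$ for $j\ge1$. Two $t$-tuples $(\mathcal{U}_1,\ldots,\mathcal{U}_t)$, $(\mathcal{V}_1,\ldots,\mathcal{V}_t)$ of $\mathbb{F}_q$-subspaces of $\mathbb{F}_{q^m}^k$ are equivalent if there exist $A\in\mathrm{GL}(k,q^m)$, $\gamma_1,\ldots,\gamma_t\in\mathbb{F}_{q^m}^*$ and a permutation $\sigma$ of $\{1,\ldots,t\}$ with $\mathcal{U}_i=\{\gamma_iAv:v\in\mathcal{V}_{\sigma(i)}\}$ for every $i$ (vectors as columns). *)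

(* Defs.v *)
From HB Require Import structures.
From mathcomp Require Import all_boot all_order perm all_algebra.

Set Implicit Arguments.
Unset Strict Implicit.
Unset Printing Implicit Defensive.

Import GRing.Theory.
Local Open Scope ring_scope.

Definition prime_power (q : nat) : Prop :=
  exists p e : nat, [/\ prime p, (0 < e)%N & q = (p ^ e)%N].

Section Defs.

(* The field L plays the role of F_{q^m}, under the hypotheses that q is a
   prime power and #|L| = q ^ m; x |-> x ^+ q is then an automorphism of L, so
   that [finv] is its genuine inverse, and its fixed points form F_q. *)
Variables (L : finFieldType) (q : nat).

Definition frob (x : L) : L := x ^+ q.

(* frobz r x is x^{q^r} for r in Z. *)
Definition frobz (r : int) (x : L) : L :=
  match r with
  | Posz n => iter n frob x
  | Negz n => iter n.+1 (finv frob) x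
  end.

(* pnorm u j a is N_u^j(a); the norm N_u(a) is pnorm u m a. *)
Definition pnorm (u : int) (j : nat) (a : L) : L :=
  \prod_(i < j) frobz (u * i%:Z) a.

Definition is_Fq_subspace (k : nat) (W : {set 'cV[L]_k}) : Prop :=
  [/\ 0 \in W,
      {in W &, forall v w, v + w \in W}
    & forall (c : L) (v : 'cV[L]_k), frob c = c -> v \in W -> c *: v \in W].

Definition tuple_equiv (k t : nat) (U V : 'I_t -> {set 'cV[L]_k}) : Prop :=
  [/\ forall i, is_Fq_subspace (U i),
      forall i, is_Fq_subspace (V i)
    & exists (A : 'M[L]_k) (g : 'I_t -> L) (sigma : 'S_t),
        [/\ A \in unitmx,
            forall i, g i != 0
          & forall i, U i = [set g i *: (A *m v) | v in V (sigma i)]]].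

Definition Uspace (k : nat) (u : int) (a : L) : {set 'cV[L]_k} :=
  [set \col_(j < k) (pnorm u j a * frobz (u * j%:Z) x) | x : L].

End Defs.

(* Main.v *)
Require Import Defs.
From HB Require Import structures.
From mathcomp Require Import all_boot all_order perm all_algebra.
From mathcomp Require Import finfield zify.

Set Implicit Arguments.
Unset Strict Implicit.
Unset Printing Implicit Defensive.

Import GRing.Theory.
Local Open Scope ring_scope.

(** Write [f] for the [s]-th power of the Frobenius. The point of parameter [x]
    in the space of [mu = f^-(k-2) (alpha^-1)], read from the last coordinate to
    the first, has [j]-th entry the product of the [f^-i (alpha^-1)] over
    [j <= i < k - 1], times [f^(k-1-j) x]. Multiplying by [N_{-s}^{k-1}(alpha)]
    turns that product into [N_{-s}^j(alpha)], so the result is the point of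
    parameter [f^(k-1) x] in the space attached to [-s] and [alpha]. One
    anti-diagonal permutation matrix thus serves all indices. *)

Section Frobenius.

Variables (L : finFieldType) (q m : nat).
Hypotheses (q_pp : prime_power q) (card_L : #|L| = (q ^ m)%N).

Lemma frobD (x y : L) : frob q (x + y) = frob q x + frob q y.
Proof.
case: q_pp => p [e [p_pr _ def_q]].
have pL : p \in [pchar L].
  by apply: (@card_finPcharP _ p (e * m)%N) => //; rewrite card_L def_q expnM.
rewrite /frob exprDn_pchar // def_q.
by rewrite pnatX (eq_pnat _ (pcharf_eq pL)) pnat_id.
Qed.

(** Additivity reduces this to a trivial kernel, and a field has no nonzero nilpotents. Injectivity
    is what makes [finv] a two-sided inverse. *)
Lemma frob_inj : injective (@frob L q).
Proof.
have q_gt0 : (0 < q)%N.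
  by case: q_pp => p [e [/prime_gt0 p_gt0 _ ->]]; rewrite expn_gt0 p_gt0.
move=> x y eq_xy; apply/eqP; rewrite -subr_eq0.
have : frob q (x - y) == 0.
  by apply/eqP/(addIr (frob q y)); rewrite -frobD subrK add0r.
by rewrite expf_eq0 q_gt0.
Qed.

Lemma frobz0 (x : L) : frobz q 0 x = x. Proof. by []. Qed.

(** This recursion holds across the sign change of [r], so later proofs can use induction on
    integers instead of the two cases of [frobz]. *)
Lemma frobzS (r : int) (x : L) : frobz q (r + 1) x = frob q (frobz q r x).
Proof.
case: r => [n|[|n]]; first by rewrite /= addn1.
  by rewrite NegzE addNr /= f_finv //; apply: frob_inj.
have -> : Negz n.+1 + 1 = Negz n by lia.
by rewrite /= f_finv //; apply: frob_inj.
Qed.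

Lemma frobzD (r1 r2 : int) (x : L) :
  frobz q (r1 + r2) x = frobz q r1 (frobz q r2 x).
Proof.
elim: r1 => [|n IH|n IH]; first by rewrite add0r.
  by rewrite -addn1 PoszD addrAC !frobzS IH.
apply: frob_inj; rewrite -!frobzS addrAC.
by have -> : - n.+1%:Z + 1 = - n%:Z by lia.
Qed.

(** In the negative direction, injectivity of [frob] allows one more application on both sides,
    which brings the exponent back to the induction hypothesis. Keeping [op] abstract serves both
    addition and multiplication. *)
Lemma frobz_morph2 (op : L -> L -> L) (r : int) :
  {morph @frob L q : x y / op x y} -> {morph @frobz L q r : x y / op x y}.
Proof.
move=> opM x y; elim: r => [|n IH|n IH] //.
  by rewrite -addn1 PoszD !frobzS IH opM.
apply: frob_inj; rewrite opM -!frobzS.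
by have -> : - n.+1%:Z + 1 = - n%:Z by lia.
Qed.

Lemma frobz_add (r : int) : {morph @frobz L q r : x y / x + y}.
Proof. exact/frobz_morph2/frobD. Qed.

Lemma frobz_mul (r : int) : {morph @frobz L q r : x y / x * y}.
Proof. by apply: frobz_morph2 => x y; apply: exprMn. Qed.

Lemma frobz_id (r : int) (x : L) : frob q x = x -> frobz q r x = x.
Proof.
move=> fx; elim: r => [|n IH|n IH] //; first by rewrite -addn1 PoszD frobzS IH.
apply: frob_inj; rewrite -frobzS.
have -> : - n.+1%:Z + 1 = - n%:Z by lia.
by rewrite IH.
Qed.

Lemma frobz_zero (r : int) : frobz q r (0 : L) = 0.
Proof. by apply: (addrI (frobz q r 0)); rewrite -frobz_add !addr0. Qed.

Lemma frobz_inv (r : int) (x : L) : frobz q r x^-1 = (frobz q r x)^-1.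
Proof.
(* At 0 the identity rests on the convention that the inverse of 0 is 0. *)
have [->|x_neq0] := eqVneq x 0; first by rewrite invr0 frobz_zero invr0.
have f1 : frobz q r (1 : L) = 1 by apply: frobz_id; apply: expr1n.
by apply: divr1_eq; rewrite invrK -frobz_mul mulVf.
Qed.

Lemma frobz_neq0 (r : int) (x : L) : x != 0 -> frobz q r x != 0.
Proof.
move=> x_neq0; apply/eqP => fx0; move/eqP: x_neq0; apply.
by rewrite -[x]frobz0 -(addNr r) frobzD fx0 frobz_zero.
Qed.

Lemma pnorm_neq0 (u : int) (j : nat) (a : L) : a != 0 -> pnorm q u j a != 0.
Proof. by move=> a_neq0; apply/prodf_neq0 => i _; apply: frobz_neq0. Qed.

Lemma Uspace_subspace (k : nat) (u : int) (a : L) :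
  is_Fq_subspace q (Uspace q k u a).
Proof.
split=> [|v w /imsetP[x _ ->] /imsetP[y _ ->]|c v fc /imsetP[x _ ->]].
- apply/imsetP; exists 0 => //; apply/colP => j.
  by rewrite !mxE frobz_zero mulr0.
- apply/imsetP; exists (x + y) => //; apply/colP => j.
  by rewrite !mxE frobz_add mulrDr.
apply/imsetP; exists (c * x) => //; apply/colP => j.
by rewrite !mxE frobz_mul (frobz_id _ fc) mulrCA.
Qed.

(** To be used with [n = k - 1], where the shift [n - 1] is [k - 2]. This shift makes the factors of
    the second norm, listed backwards, the inverses of the last [n - j] factors of the first. *)
Lemma pnorm_reversed (s : int) (n j : nat) (a : L) : a != 0 -> (j <= n)%N ->
  pnorm q (- s) n a *
    pnorm q s (n - j) (frobz q (- (s * (n%:Z - 1))) a^-1) = pnorm q (- s) j a.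
Proof.
move=> a_neq0 le_jn.
have -> : pnorm q s (n - j) (frobz q (- (s * (n%:Z - 1))) a^-1)
        = \prod_(j <= i < n) (frobz q (- s * i%:Z) a)^-1.
  rewrite /pnorm -[in RHS](add0n j) big_addn big_nat_rev big_mkord /=.
  apply: eq_bigr => i _; rewrite -frobz_inv -frobzD; congr frobz.
  (* After reversal and translation by [j], the index [i] has become [n - 1 - i]. *)
  have -> : (0 + (n - j) - i.+1 + j)%N%:Z = n%:Z - 1 - i%:Z.
    by have := ltn_ord i; lia.
  by rewrite mulNr -opprB -mulrN opprB mulrBr; lia.
rewrite /pnorm -!(big_mkord xpredT (fun i => frobz q (- s * i%:Z) a)).
rewrite (big_cat_nat (leq0n j) le_jn) /=.
rewrite -mulrA -big_split -[RHS]mulr1; congr (_ * _); apply: big1 => i _ /=.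
by rewrite mulfV ?frobz_neq0.
Qed.

Lemma Uspace_neg_reversed (k : nat) (s : int) (a : L) : (0 < k)%N -> a != 0 ->
  Uspace q k (- s) a =
  [set pnorm q (- s) k.-1 a *: (perm_mx (perm (@rev_ord_inj k)) *m v)
     | v in Uspace q k s (frobz q (- (s * (k%:Z - 2%:Z))) a^-1)].
Proof.
move=> k_gt0 a_neq0; rewrite -imset_comp.
have point x : (fun v => pnorm q (- s) k.-1 a *:
      (perm_mx (perm (@rev_ord_inj k)) *m v))
    (\col_(j < k) (pnorm q s j (frobz q (- (s * (k%:Z - 2%:Z))) a^-1)
       * frobz q (s * j%:Z) x))
  = \col_(j < k) (pnorm q (- s) j a
       * frobz q (- s * j%:Z) (frobz q (s * k.-1%:Z) x)).
  apply/colP => j; rewrite -row_permE !mxE permE /= mulrA.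
  have lt_jk := ltn_ord j.
  (* The difference is taken in the integers, so [k = 1] gives the shift -1 and needs no separate
     case. *)
  have -> : k%:Z - 2%:Z = k.-1%:Z - 1 by lia.
  have -> : (k - j.+1 = k.-1 - j)%N by lia.
  rewrite pnorm_reversed //; last by lia.
  rewrite -frobzD; congr (_ * frobz _ _ _).
  by rewrite mulNr addrC -mulrBr; congr (_ * _); lia.
(* The change of parameter in [point] is a power of Frobenius, hence bijective; its inverse gives
   one inclusion and the map itself the other. *)
apply/setP => v; apply/imsetP/imsetP => -[x _ ->].
  exists (frobz q (- (s * k.-1%:Z)) x) => //.
  by rewrite /= point -frobzD subrr.
by exists (frobz q (s * k.-1%:Z) x) => //; rewrite /= point.
Qed.

End Frobenius.

Theorem theorem5p3 (q m k t s : nat) (L : finFieldType) (alpha : 'I_t -> L)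
    (q_pp : prime_power q)
    (m_gt0 : (0 < m)%N) (k_gt0 : (0 < k)%N) (t_gt0 : (0 < t)%N)
    (k_le_m : (k <= m)%N)
    (s_range : (1 <= s <= m)%N) (s_coprime : coprime s m)
    (card_L : #|L| = (q ^ m)%N)
    (alpha_neq0 : forall i, alpha i != 0)
    (norms_distinct : forall i j, i != j ->
       pnorm q s%:Z m (alpha i) != pnorm q s%:Z m (alpha j)) :
  let mu := fun i => frobz q (- (s%:Z * (k%:Z - 2%:Z))) (alpha i)^-1 in
  tuple_equiv q
    (fun i => Uspace q k (- s%:Z) (alpha i))
    (fun i => Uspace q k s%:Z (mu i)).
Proof.
move=> mu; split=> [i|i|]; try exact: Uspace_subspace q_pp card_L _ _ _.
exists (perm_mx (perm (@rev_ord_inj k))).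
(* Only the scalar depends on [i]; the spaces already match index by index, so the permutation is
   the identity. *)
exists (fun i => pnorm q (- s%:Z) k.-1 (alpha i)), 1%g; split=> [|i|i].
- exact: unitmx_perm.
- exact: (pnorm_neq0 q_pp card_L).
by rewrite perm1; apply: (Uspace_neg_reversed q_pp card_L).
Qed.
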